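(* For every positive integer $n$, the graph $C_3 \times K_n$ admits a $C_6$-decomposition.
   Context: $K_n$ is the complete graph on $n$ vertices, $C_k$ the cycle of length $k$. The tensor product $G \times H$ has vertex set $V(G)\times V(H)$, with $(g_1,h_1)$ adjacent to $(g_2,h_2)$ iff $g_1g_2 \in E(G)$ and $h_1h_2 \in E(H)$. A $C_k$-decomposition of a graph is a partition of its edge set into edge sets of subgraphs isomorphic to $C_k$. *)

(* Defs.v *)
From mathcomp Require Import all_boot.

Set Implicit Arguments.
Unset Strict Implicit.
Unset Printing Implicit Defensive.

Record sgraph := SGraph {
  vertex :> finType;
  adj : rel vertex;
  adj_sym : symmetric adj;
  adj_irrefl : irreflexive adj
}.

Definition edge_set (G : sgraph) : {set {set G}} :=
  [set e | [exists x, exists y, adj x y && (e == [set x; y])]].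

Definition isomorphic (G H : sgraph) : Prop :=
  exists2 f : G -> H, bijective f & {mono f : x y / adj x y}.

Lemma complete_adj_sym (n : nat) : symmetric (fun i j : 'I_n => i != j).
Proof. by move=> i j; rewrite eq_sym. Qed.

Lemma complete_adj_irrefl (n : nat) : irreflexive (fun i j : 'I_n => i != j).
Proof. by move=> i; rewrite eqxx. Qed.

Definition complete_graph (n : nat) : sgraph :=
  SGraph (@complete_adj_sym n) (@complete_adj_irrefl n).

(* The conjunct [i != j] only matters for [k = 1]; the result is a cycle of
   length [k] in the usual sense for [k >= 3]. *)
Definition cycle_adj (k : nat) : rel 'I_k :=
  fun i j => (i != j) && ((j == i.+1 %% k :> nat) || (i == j.+1 %% k :> nat)).

Lemma cycle_adj_sym (k : nat) : symmetric (@cycle_adj k).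
Proof. by move=> i j; rewrite /cycle_adj eq_sym orbC. Qed.

Lemma cycle_adj_irrefl (k : nat) : irreflexive (@cycle_adj k).
Proof. by move=> i; rewrite /cycle_adj eqxx. Qed.

Definition cycle_graph (k : nat) : sgraph :=
  SGraph (@cycle_adj_sym k) (@cycle_adj_irrefl k).

Definition tensor_adj (G H : sgraph) : rel (G * H) :=
  fun u v => adj u.1 v.1 && adj u.2 v.2.

Lemma tensor_adj_sym (G H : sgraph) : symmetric (@tensor_adj G H).
Proof. by move=> u v; rewrite /tensor_adj adj_sym [adj u.2 _]adj_sym. Qed.

Lemma tensor_adj_irrefl (G H : sgraph) : irreflexive (@tensor_adj G H).
Proof. by move=> u; rewrite /tensor_adj adj_irrefl. Qed.

Definition tensor (G H : sgraph) : sgraph :=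
  SGraph (@tensor_adj_sym G H) (@tensor_adj_irrefl G H).

Record subgraph (G : sgraph) := Subgraph {
  sub_vertices : {set G};
  sub_edges : {set {set G}};
  sub_edges_in : sub_edges \subset edge_set G;
  sub_edges_incident : forall e, e \in sub_edges -> e \subset sub_vertices
}.

Definition sub_adj (G : sgraph) (S : subgraph G) :
    rel {x : G | x \in sub_vertices S} :=
  fun x y => [set val x; val y] \in sub_edges S.

Lemma sub_adj_sym (G : sgraph) (S : subgraph G) : symmetric (@sub_adj G S).
Proof. by move=> x y; rewrite /sub_adj setUC. Qed.

Lemma sub_adj_irrefl (G : sgraph) (S : subgraph G) : irreflexive (@sub_adj G S).
Proof.
move=> x; apply/negP; rewrite /sub_adj setUid => xS.
have := subsetP (sub_edges_in S) _ xS; rewrite inE.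
case/existsP=> a /existsP[b /andP[ab /eqP exab]].
have /set1P ax : a \in [set val x] by rewrite exab set21.
have /set1P bx : b \in [set val x] by rewrite exab set22.
by rewrite ax bx adj_irrefl in ab.
Qed.

Definition graph_of_subgraph (G : sgraph) (S : subgraph G) : sgraph :=
  SGraph (@sub_adj_sym G S) (@sub_adj_irrefl G S).

(* The library's [partition] also forbids empty blocks, which is no restriction
   here as soon as [H] has an edge. *)
Definition has_decomposition (H G : sgraph) : Prop :=
  exists2 D : {set {set {set G}}}, partition D (edge_set G) &
    forall F, F \in D ->
      exists2 S : subgraph G, isomorphic (graph_of_subgraph S) H &
        F = sub_edges S.

(* Main.v *)
Require Import Defs.
From mathcomp Require Import all_boot.

(** [C_3 x K_2] is itself a 6-cycle, and the edges [{a, b}] of [K_n] partition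
    [C_3 x K_n] into copies of [C_3 x K_2]. *)

(** Every edge of the product projects under [snd] to an edge of [K_n], so its edges fall into
    disjoint fibres, one for each edge [{a, b}] of [K_n]. The fibre over [{a, b}] is a copy of
    [C_3 x K_2] ([mem_edges_over_pair]), and the Chinese remainder theorem turns this into [C_6]:
    pairs of residues mod 3 and mod 2 are residues mod 6, with matching adjacency
    ([cycle_adj_crt6]). *)

Lemma edge_set_adj {G : sgraph} (x y : G) :
  ([set x; y] \in edge_set G) = adj x y.
Proof.
rewrite inE; apply/existsP/idP => [[a /existsP[b /andP[ab /eqP exy]]]|xy].
  have : x \in [set a; b] by rewrite -exy set21.
  have : y \in [set a; b] by rewrite -exy set22.
  have : a \in [set x; y] by rewrite exy set21.
  have : b \in [set x; y] by rewrite exy set22.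
  rewrite !inE => /orP[]/eqP ? /orP[]/eqP ? /orP[]/eqP ? /orP[]/eqP ?; subst;
    by rewrite ?ab // ?[adj x y]adj_sym ?ab.
by exists x; apply/existsP; exists y; rewrite xy eqxx.
Qed.

(* The residue mod 6 congruent to [i] mod 3 and to [s] mod 2. *)
Definition crt6 (i : 'I_3) (s : bool) : 'I_6 := inord ((4 * i + 3 * s) %% 6).

Lemma val_crt6 (i : 'I_3) (s : bool) :
  crt6 i s = (4 * i + 3 * s) %% 6 :> nat.
Proof. by rewrite inordK // ltn_mod. Qed.

Lemma crt6_mod3 (i : 'I_3) (s : bool) : inord (crt6 i s %% 3) = i.
Proof.
by apply/val_inj; rewrite /= inordK ?ltn_mod // val_crt6;
   case: i => [[|[|[|i]]] // hi]; case: s.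
Qed.

Lemma odd_crt6 (i : 'I_3) (s : bool) : odd (crt6 i s) = s.
Proof. by rewrite val_crt6; case: i => [[|[|[|i]]] // hi]; case: s. Qed.

Lemma crt6K (k : 'I_6) : crt6 (inord (k %% 3)) (odd k) = k.
Proof.
by apply/val_inj; rewrite /= val_crt6 inordK ?ltn_mod //;
   case: k => [[|[|[|[|[|[|k]]]]]] // hk].
Qed.

(** A difference mod 6 is 1 or -1 exactly when it is odd and nonzero mod 3, and in [C_3] distinct
    residues are always adjacent. *)
Lemma cycle_adj_crt6 (i j : 'I_3) (s t : bool) :
  cycle_adj (crt6 i s) (crt6 j t) = cycle_adj i j && (s != t).
Proof.
rewrite /cycle_adj -!val_eqE /= !val_crt6.
by case: i => [[|[|[|i]]] // hi]; case: j => [[|[|[|j]]] // hj];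
   case: s; case: t.
Qed.

Definition edges_over (G : sgraph) {H : sgraph} (P : {set H}) : {set {set tensor G H}} :=
  [set e in edge_set (tensor G H) | snd @: e == P].

Lemma edges_over_sub (G : sgraph) {H : sgraph} (P : {set H}) :
  edges_over G P \subset edge_set (tensor G H).
Proof. by apply/subsetP => e; rewrite inE => /andP[]. Qed.

Lemma edges_over_incident (G : sgraph) {H : sgraph} (P : {set H})
    (e : {set tensor G H}) :
  e \in edges_over G P -> e \subset [set x : tensor G H | x.2 \in P].
Proof.
rewrite inE => /andP[_ /eqP <-].
by apply/subsetP => x xe; rewrite inE imset_f.
Qed.

Definition subgraph_over (G : sgraph) {H : sgraph} (P : {set H}) :
    subgraph (tensor G H) :=
  Subgraph (edges_over_sub G P) (edges_over_incident G P).

(** The bit [_ == b] tells the two endpoints apart, which puts adjacency over [{a, b}] in the form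
    produced by [cycle_adj_crt6]. *)
Lemma mem_edges_over_pair {G H : sgraph} {a b : H} {x y : tensor G H} :
    adj a b -> x.2 \in [set a; b] -> y.2 \in [set a; b] ->
  ([set x; y] \in edges_over G [set a; b]) =
    adj x.1 y.1 && ((x.2 == b) != (y.2 == b)).
Proof.
move=> ab; have neq_ab : a != b by apply: contraTneq ab => ->; rewrite adj_irrefl.
rewrite in_set2 => xP; rewrite in_set2 => yP.
rewrite in_set edge_set_adj imsetU1 imset_set1 /= /tensor_adj.
by case/orP: xP => /eqP->; case/orP: yP => /eqP->;
   rewrite ?[[set b; a]]setUC ?[adj b a]adj_sym;
   rewrite ?(eqxx, adj_irrefl, negPf neq_ab, ab, andbF, andbT).
Qed.

Lemma C3_over_edge_isomorphic {H : sgraph} {a b : H} : adj a b ->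
  isomorphic (graph_of_subgraph (subgraph_over (cycle_graph 3) [set a; b]))
             (cycle_graph 6).
Proof.
move=> ab; have neq_ab : a != b by apply: contraTneq ab => ->; rewrite adj_irrefl.
pose T := tensor (cycle_graph 3) H.
pose V := [set x : T | x.2 \in [set a; b]].
have memV (x : T) : x \in V -> x.2 \in [set a; b] by rewrite in_set.
pose f (x : {x : T | x \in V}) : 'I_6 := crt6 (val x).1 ((val x).2 == b).
(* Inverse of [f]: the residue mod 3 recovers the [C_3] coordinate, and the parity selects the
   endpoint. *)
pose g0 (k : 'I_6) : T := (inord (k %% 3), if odd k then b else a).
have g0V k : g0 k \in V by rewrite in_set in_set2 /=; case: odd; rewrite eqxx ?orbT.
exists f.
  exists (fun k => Sub (g0 k) (g0V k)) => [[[i c] xV] | k].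
    apply/val_inj; rewrite /= /g0 /f /= crt6_mod3 odd_crt6.
    by case/set2P: (memV _ xV) => /= ->; rewrite ?eqxx ?(negPf neq_ab).
  rewrite /f /= -[RHS]crt6K; congr crt6.
  by case: odd; rewrite ?eqxx ?(negPf neq_ab).
move=> [x xV] [y yV].
apply: etrans (esym (mem_edges_over_pair ab (memV _ xV) (memV _ yV))).
exact: cycle_adj_crt6.
Qed.

Theorem theorem4p1 (n : nat) (hn : 0 < n) :
  has_decomposition (cycle_graph 6) (tensor (cycle_graph 3) (complete_graph n)).
Proof.
set G := tensor _ _.
(* The blocks are the nonempty fibres of the projection of edges to [K_n]. *)
exists (preim_partition (fun e : {set G} => snd @: e) (edge_set G)).
  exact: preim_partitionP.
move=> F /imsetP[e eG ->].
have: e \in edge_set G by [].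
rewrite inE => /existsP[x /existsP[y /andP[/andP[_ xy2] /eqP exy]]].
(* The block of [e = {x, y}] is the fibre over its projection, and [xy2] makes that projection an
   edge. *)
exists (subgraph_over (cycle_graph 3) [set x.2; y.2]).
  exact: C3_over_edge_isomorphic.
by apply/setP => e'; rewrite !inE exy imsetU1 imset_set1 [X in _ && X]eq_sym.
Qed.
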